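(* For all integers $n,k$ with $1\le k\le n-1$, $$\frac{d_n^{k-1}}{\binom{n}{k-1}}\cdot\frac{d_n^{k+1}}{\binom{n}{k+1}}\ \ge\ \left(\frac{d_n^k}{\binom{n}{k}}\right)^2,$$ or equivalently, $$(n-k+1)(k+1)\,d_n^{k-1}d_n^{k+1}\ \ge\ k(n-k)\left(d_n^k\right)^2.$$
   Context: Euler's difference table $(e_n^k)_{0\le k\le n}$ (for integers $n\ge 0$) is defined by $e_n^n=n!$ for $n\ge 0$ and $e_n^{k-1}=e_n^k-e_{n-1}^{k-1}$ for $1\le k\le n$. Define $d_n^k=e_n^k/k!$ for $0\le k\le n$. *)

(* Defs.v *)
From mathcomp Require Import all_boot all_order all_algebra.

Set Implicit Arguments.
Unset Strict Implicit.
Unset Printing Implicit Defensive.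

Import Order.TTheory GRing.Theory Num.Theory.
Local Open Scope ring_scope.

(* Diagonals of Euler's difference table: [euler_diag j k] is e_{k+j}^k.  The
   defining rule e_n^{k-1} = e_n^k - e_{n-1}^{k-1}, shifted by one in k and read
   at n = k+j+1, is a structural recursion on j = n - k. *)
Fixpoint euler_diag (j k : nat) : int :=
  if j is j'.+1 then euler_diag j' k.+1 - euler_diag j' k else (k`!)%:Z.

(* e_n^k, meaningful for k <= n only (for k > n the value is the junk k!). *)
Definition euler_e (n k : nat) : int := euler_diag (n - k) k.

Definition euler_d (n k : nat) : rat := (euler_e n k)%:~R / (k`!)%:R.

Lemma euler_e_diag (n : nat) : euler_e n n = (n`!)%:Z.
Proof. by rewrite /euler_e subnn. Qed.

Lemma euler_e_rec (n k : nat) : (1 <= k <= n)%N ->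
  euler_e n (k - 1) = euler_e n k - euler_e (n - 1) (k - 1).
Proof.
case: k => // k; case: n => // n /= lekn.
by rewrite /euler_e !subn1 /= subSS subSn.
Qed.

(* Main.v *)
(* With E j k = e_{k+j}^k, the integrals E j k = \int x^k (x-1)^j e^{-x} dx
   suggest the "integration by parts" rule E j (k+1) = (k+1) E j k + j E (j-1) (k+1),
   which together with the defining rule shows E >= 0.  Since
   d_n^k / binom(n,k) = e_n^k (n-k)! / n!, both inequalities amount to
     (j+1) E (j+1) (k-1) E (j-1) (k+1) >= j (E j k)^2,   j = n - k.
   The three entries are linear forms in C = E j (k-1) and D = E (j-1) (k-1),
   and the difference of the two sides is a quadratic form in C, D with
   nonnegative coefficients. *)
Require Import Defs.
From mathcomp Require Import all_boot all_order all_algebra.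
From mathcomp Require Import zify ring.
Import Order.TTheory GRing.Theory Num.Theory.
Local Open Scope ring_scope.

Lemma euler_diagS (j k : nat) :
  euler_diag j.+1 k = euler_diag j k.+1 - euler_diag j k.
Proof. by []. Qed.

Lemma euler_diag_parts (j k : nat) :
  euler_diag j k.+1 =
    k.+1%:R * euler_diag j k + j%:R * euler_diag j.-1 k.+1.
Proof.
elim: j k => [|j IHj] k.
  by rewrite /= mul0r addr0 factS PoszM natz.
rewrite /= (IHj k.+1) [euler_diag j k.+1 as X in _ - X]IHj.
(* At [j = 0] the terms in [j.-1] carry coefficient zero; otherwise their difference collapses to
   [euler_diag j k.+1] by the defining rule. *)
case: j IHj => [|j] IHj.
  by rewrite !mul0r !addr0 (IHj k) /=; ring.
by rewrite !euler_diagS; ring.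
Qed.

(** Parts turns the defining difference into [k * euler_diag j k + j * euler_diag j.-1 k.+1], free
    of subtraction, so strong induction on the first index applies. *)
Lemma euler_diag_ge0 (j k : nat) : 0 <= euler_diag j k.
Proof.
elim/ltn_ind: j k => -[|j] IHj k; first by [].
rewrite euler_diagS euler_diag_parts -natr1 mulrDl mul1r addrAC addrK.
by rewrite addr_ge0 // mulr_ge0 // IHj //; case: (j).
Qed.

Lemma euler_diag_log_convex (m l : nat) :
  m.+1%:R * euler_diag m.+1 l.+1 ^+ 2
    <= m.+2%:R * (euler_diag m.+2 l * euler_diag m l.+2).
Proof.
have hC := euler_diag_ge0 m.+1 l; have hD := euler_diag_ge0 m l.
have eB : euler_diag m l.+1 = euler_diag m.+1 l + euler_diag m l.
  by rewrite euler_diagS subrK.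
have eA := euler_diag_parts m.+1 l; rewrite succnK eB in eA.
have eX := euler_diagS m.+1 l.
have eY : euler_diag m l.+2 = euler_diag m.+1 l.+1 + euler_diag m l.+1.
  by rewrite (euler_diagS m l.+1) subrK.
rewrite eX eY eB.
move: eA hC hD; set A := euler_diag m.+1 l.+1; set C := euler_diag m.+1 l.
set D := euler_diag m l => -> hC hD.
(* Here A = (m+l+2)C + (m+1)D, and the outer entries are A - C and A + C + D, so the gap is A^2 +
   (m+2)(AD - C^2 - CD); the C^2 and CD terms of A^2 absorb the negative ones. *)
rewrite -subr_ge0 [leRHS](_ : _ =
  ((m.+2 * m.+1 + 2 * m.+2 * l + l * l)%N)%:R * C ^+ 2
  + (((3 * m + 3) * m.+2 + (3 * m + 4) * l)%N)%:R * (C * D)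
  + ((m.+1 * (2 * m + 3))%N)%:R * D ^+ 2); last by ring.
by rewrite !addr_ge0 ?mulr_ge0 ?exprn_ge0.
Qed.

Lemma euler_d_binomial (n k : nat) : (k <= n)%N ->
  euler_d n k / 'C(n, k)%:R =
    (euler_diag (n - k) k)%:~R * ((n - k)`!)%:R / (n`!)%:R.
Proof.
move=> lekn; rewrite /euler_d /euler_e -(bin_fact lekn) !natrM.
have h1 : (k`!)%:R != 0 :> rat by rewrite pnatr_eq0 -lt0n fact_gt0.
have h2 : ((n - k)`!)%:R != 0 :> rat by rewrite pnatr_eq0 -lt0n fact_gt0.
have h3 : ('C(n, k))%:R != 0 :> rat by rewrite pnatr_eq0 -lt0n bin_gt0.
by field; rewrite h1 h2 h3.
Qed.

Theorem theorem3p1 (n k : nat) (hk : (1 <= k <= n - 1)%N) :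
  (euler_d n (k - 1) / 'C(n, k - 1)%:R) * (euler_d n (k + 1) / 'C(n, k + 1)%:R)
    >= (euler_d n k / 'C(n, k)%:R) ^+ 2
  /\
  (n%:R - k%:R + 1) * (k%:R + 1) * euler_d n (k - 1) * euler_d n (k + 1)
    >= k%:R * (n%:R - k%:R) * euler_d n k ^+ 2.
Proof.
case: k hk => [|l] // hk.
(* With [l = k - 1] and [m = n - k - 1], the three entries lie on diagonals [m.+2], [m.+1] and
   [m]. *)
have [m ->] : exists m, n = (m + l.+2)%N by exists (n - l.+2)%N; lia.
have -> : (l.+1 - 1 = l)%N by lia.
have -> : (l.+1 + 1 = l.+2)%N by lia.
have nl : (m + l.+2 - l = m.+2)%N by lia.
have nl1 : (m + l.+2 - l.+1 = m.+1)%N by lia.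
have nl2 : (m + l.+2 - l.+2 = m)%N by lia.
have H := euler_diag_log_convex m l.
rewrite -(ler_int rat) !intrM -expr2 !rmorph_nat in H.
split; last first.
  rewrite /euler_d /euler_e nl nl1 nl2.
  move: H; set A := _%:~R; set X := _%:~R; set Y := _%:~R => H.
  have -> : (m + l.+2)%:R - l.+1%:R = m.+1%:R :> rat.
    by rewrite -natrB ?nl1 //; lia.
  rewrite !factS !natrM.
  have : (l`!)%:R != 0 :> rat by rewrite pnatr_eq0 -lt0n fact_gt0.
  set F := (l`!)%:R => F0.
  (* The factors k and k+1 cancel against the factorials, leaving the common denominator (l+1)
     l!^2. *)
  rewrite -subr_ge0 [leRHS](_ : _ =
    (m.+2%:R * (X * Y) - m.+1%:R * A ^+ 2) / (l.+1%:R * F ^+ 2)); last first.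
    by field; rewrite F0 nat1r -natrD !pnatr_eq0.
  by rewrite divr_ge0 ?subr_ge0 // mulr_ge0 ?exprn_ge0.
rewrite !euler_d_binomial ?nl ?nl1 ?nl2; try lia.
move: H; set A := _%:~R; set X := _%:~R; set Y := _%:~R => H.
rewrite !factS !natrM.
set F := (m`!)%:R; set N := ((m + l.+2)`!)%:R.
(* Both m! (m+2)! and (m+1)!^2 contain (m+1) m!^2; the cofactors m+2 and m+1 are the weights in
   [H]. *)
rewrite -subr_ge0 [leRHS](_ : _ =
  m.+1%:R * (F / N) ^+ 2 * (m.+2%:R * (X * Y) - m.+1%:R * A ^+ 2)); last by ring.
by rewrite mulr_ge0 ?subr_ge0 // mulr_ge0 ?exprn_ge0 ?divr_ge0.
Qed.
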